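(* For every nonnegative integer $n$, $$q_{odd}'''(n)=\sum_{j=-\infty}^{\infty}pod(n-j^2).$$
   Context: $pod(n)$ denotes the number of partitions of $n$ in which odd parts are distinct and even parts may be repeated, with $pod(0)=1$ and $pod(m)=0$ for $m<0$. $q_{odd}'''(n)$ denotes the number of partitions of $n$ into distinct odd parts in $3$ colors (each odd number is available in three colors, and each colored odd number is used at most once), so that $\sum_{n\ge0}q_{odd}'''(n)q^n=\prod_{k\ge0}(1+q^{2k+1})^3$; for example $q_{odd}'''(4)=9$. *)

(* Defs.v *)
From HB Require Import structures.
From mathcomp Require Import all_boot all_order all_algebra.
From mathcomp Require Import zify.
From mathcomp Require Export boolp classical_sets functions cardinality fsbigop.

Set Implicit Arguments.
Unset Strict Implicit.
Unset Printing Implicit Defensive.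

Definition is_partition (n : nat) (s : seq nat) : bool :=
  [&& sorted geq s, all (ltn 0) s & sumn s == n].

Definition odd_parts_distinct (s : seq nat) : bool := uniq [seq i <- s | odd i].

Definition parts (n : nat) (s : {bseq n of 'I_n.+1}) : seq nat :=
  [seq nat_of_ord i | i <- s].

(* A partition of n has at most n parts, each at most n, so that it is the list
   of parts of exactly one bounded sequence; see partition_parts. *)
Definition pod_nat (n : nat) : nat :=
  #|[set s : {bseq n of 'I_n.+1} |
      is_partition n (parts s) && odd_parts_distinct (parts s)]|.

Definition pod (m : int) : nat :=
  match m with
  | Posz n => pod_nat n
  | Negz _ => 0
  end.

(* A partition of n into distinct coloured odd parts is a finite set of pairs
   (part, colour); a part of a partition of n is at most n. *)
Definition qodd3 (n : nat) : nat :=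
  #|[set A : {set 'I_n.+1 * 'I_3} |
      [forall x in A, odd x.1] && (\sum_(x in A) x.1 == n)]|.

Lemma partition_parts (n : nat) (s : seq nat) :
  is_partition n s -> exists! b : {bseq n of 'I_n.+1}, parts b = s.
Proof.
case/and3P=> _ s_gt0 /eqP s_sum.
have size_s : size s <= n.
  rewrite -s_sum; elim: s s_gt0 {s_sum} => //= x s IHs /andP[x_gt0 /IHs].
  lia.
have s_le : all (fun i => i < n.+1) s.
  have : sumn s <= n by rewrite s_sum.
  by elim: s {s_gt0 s_sum size_s} => //= x s IHs xs_le; rewrite IHs; lia.
have vK : [seq nat_of_ord i | i <- [seq inord i : 'I_n.+1 | i <- s]] = s.
  rewrite -map_comp -[RHS]map_id; apply/eq_in_map => i /(allP s_le) i_lt /=.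
  by rewrite inordK.
have size_v : size [seq inord i : 'I_n.+1 | i <- s] <= n by rewrite size_map.
exists (Bseq size_v); split=> [|b bs]; first exact: vK.
by apply/val_inj/(inj_map val_inj); rewrite /= vK -bs.
Qed.

Local Open Scope classical_set_scope.
Local Open Scope ring_scope.

Lemma pod_square_finite (n : nat) :
  finite_set [set j : int | pod (n%:Z - j ^+ 2) <> 0%N].
Proof.
apply: (@sub_finite_set _ _
  ((fun k : nat => k%:Z - n%:Z) @` `I_(n + n).+1)); last first.
  exact/finite_image/finite_II.
move=> j /=; case E: (n%:Z - j ^+ 2) => [m|m] // _.
exists (`|(j + n%:Z)%R|%N); move: E; rewrite ?expr2 /=; nia.
Qed.

(* Main.v *)
(** Split one of the three colours off: it supplies the distinct odd parts of a
    [pod] partition.  For the other two colours, the Jacobi triple product at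
    [z = 1] gives
      [prod_k (1 + q^(2k+1))^2 = (sum_j q^(j^2)) * prod_k 1 / (1 - q^(2k))],
    whose last factor supplies the even parts.  Only coefficients up to [q^n]
    matter, so everything is done with polynomials modulo [X^(n+1)]: the triple
    product is replaced by its finite form
      [prod_(k < N) (1 + q^(2k+1))^2 = sum_j q^(j^2) [2N choose N+j]_(q^2)],
    in which the q-binomials with [|j| <= n] agree with [prod_k 1 / (1 - q^(2k))]
    modulo [q^(n+1)] as soon as [N = 2n]. *)
Require Import Defs.
From mathcomp Require Import all_boot all_order all_algebra.
From mathcomp Require Import boolp classical_sets fsbigop.
From mathcomp Require Import zify ring.

Set Implicit Arguments.
Unset Strict Implicit.
Unset Printing Implicit Defensive.

Import Order.TTheory GRing.Theory Num.Theory.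

Local Open Scope classical_set_scope.
Local Open Scope ring_scope.

(** * Congruence of polynomials modulo [X^(n+1)] *)

Section EqUpto.
Variables (R : comNzRingType) (n : nat).
Implicit Types p q r : {poly R}.

Definition eq_upto p q := forall i, (i <= n)%N -> p`_i = q`_i.

Lemma eq_upto_refl p : eq_upto p p.
Proof. by []. Qed.

Lemma eq_upto_sym p q : eq_upto p q -> eq_upto q p.
Proof. by move=> pq i /pq. Qed.

Lemma eq_upto_trans q p r : eq_upto p q -> eq_upto q r -> eq_upto p r.
Proof. by move=> pq qr i i_le; rewrite pq // qr. Qed.

Lemma eq_uptoM p1 q1 p2 q2 :
  eq_upto p1 q1 -> eq_upto p2 q2 -> eq_upto (p1 * p2) (q1 * q2).
Proof.
move=> pq1 pq2 i i_le; rewrite !coefM; apply: eq_bigr => j _.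
by rewrite pq1 ?pq2 //; have := ltn_ord j; lia.
Qed.

Lemma eq_upto_sum I (s : seq I) (P : pred I) (F G : I -> {poly R}) :
    (forall i, P i -> eq_upto (F i) (G i)) ->
  eq_upto (\sum_(i <- s | P i) F i) (\sum_(i <- s | P i) G i).
Proof.
by move=> FG i i_le; rewrite !coef_sum; apply: eq_bigr => j /FG ->.
Qed.

Lemma eq_upto_prod1 I (s : seq I) (P : pred I) (F : I -> {poly R}) :
    (forall i, P i -> eq_upto (F i) 1) -> eq_upto (\prod_(i <- s | P i) F i) 1.
Proof.
move=> F1; elim/big_rec: _ => [|i p Pi p1]; first exact: eq_upto_refl.
by rewrite -[1]mulr1; apply: eq_uptoM => //; apply: F1.
Qed.

Lemma eq_upto_prod_tail (K : nat) (P : pred nat) (F : nat -> {poly R}) :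
    (forall i, (n < i)%N -> eq_upto (F i) 1) -> (n <= K)%N ->
  eq_upto (\prod_(i < K.+1 | P i) F i) (\prod_(i < n.+1 | P i) F i).
Proof.
move=> F1 /subnKC <-; elim: (K - n)%N => [|k IHk].
  by rewrite addn0; apply: eq_upto_refl.
rewrite addnS big_mkcond big_ord_recr -big_mkcond /=.
rewrite -[X in eq_upto _ X]mulr1; apply: eq_uptoM => //.
by case: ifP => _; [apply: F1; lia | apply: eq_upto_refl].
Qed.

Lemma eq_uptoXn0 k : (n < k)%N -> eq_upto 'X^k 0.
Proof. by move=> k_gt i i_le; rewrite coefXn coef0 (_ : i == k = false) //; lia. Qed.

Lemma eq_upto_1DXn k : (n < k)%N -> eq_upto (1 + 'X^k) 1.
Proof. by move=> k_gt i i_le; rewrite coefD eq_uptoXn0 // coef0 addr0. Qed.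

Lemma eq_upto_1BXn k : (n < k)%N -> eq_upto (1 - 'X^k) 1.
Proof. by move=> k_gt i i_le; rewrite coefB eq_uptoXn0 // coef0 subr0. Qed.

End EqUpto.

(** * Gaussian binomials and the q-binomial theorem *)

Section QBinomial.
Variables (R : comNzRingType) (q : R).

(** The Gaussian binomial, through the q-Pascal rule: no division, so it makes sense at [q = 'X^2]
    in a polynomial ring. *)
Fixpoint qbinom (m k : nat) : R :=
  match m, k with
  | _, 0 => 1
  | 0, _.+1 => 0
  | m'.+1, k'.+1 => qbinom m' k' + q ^+ k * qbinom m' k
  end.

Lemma qbinom0 m : qbinom m 0 = 1.
Proof. by case: m. Qed.

Lemma qbinomS m k : qbinom m.+1 k.+1 = qbinom m k + q ^+ k.+1 * qbinom m k.+1.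
Proof. by []. Qed.

Lemma qbinom_small m k : (m < k)%N -> qbinom m k = 0.
Proof.
elim: m k => [|m IHm] [|k] //= k_gt.
by rewrite !IHm ?mulr0 ?addr0 //; lia.
Qed.

Definition qfact (m : nat) : R := \prod_(i < m) (1 - q ^+ i.+1).

Lemma qfactS m : qfact m.+1 = qfact m * (1 - q ^+ m.+1).
Proof. by rewrite /qfact big_ord_recr. Qed.

(** The quotient formula with denominators cleared. The induction rests on
    [1 - q^(s+t) = (1 - q^s) + q^s (1 - q^t)] with [s = a+1] and [t = b+1]. *)
Lemma qbinomM_qfact a b : qbinom (a + b) a * qfact a * qfact b = qfact (a + b).
Proof.
have [m] := ubnP (a + b)%N; elim: m a b => // m IHm [|a] [|b] lt_m.
- by rewrite /qfact !big_ord0 !mulr1.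
- by rewrite qbinom0 {1}/qfact big_ord0 !mul1r.
- rewrite addn0 {2}/qfact big_ord0 mulr1.
  have := IHm a 0%N; rewrite !addn0 {2}/qfact big_ord0 mulr1 => IHa.
  by rewrite qbinomS (@qbinom_small a a.+1) // mulr0 addr0 qfactS mulrA IHa //; lia.
- have IHa : qbinom (a + b.+1) a * qfact a * qfact b.+1 = qfact (a + b.+1).
    by apply: IHm; lia.
  have : qbinom (a.+1 + b) a.+1 * qfact a.+1 * qfact b = qfact (a.+1 + b).
    by apply: IHm; lia.
  rewrite addSnnS => IHb.
  rewrite addSn qbinomS [in RHS]qfactS -addSn exprD.
  transitivity ((1 - q ^+ a.+1) * (qbinom (a + b.+1) a * qfact a * qfact b.+1) +
      q ^+ a.+1 * (1 - q ^+ b.+1) *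
      (qbinom (a + b.+1) a.+1 * qfact a.+1 * qfact b)).
    by rewrite !qfactS; ring.
  by rewrite IHa IHb; ring.
Qed.

(** Induction on [m]: removing the factor [y + x] leaves the product for [x * q], and the q-Pascal
    rule recombines the two sums. *)
Lemma qbinomial_theorem (x y : R) (m : nat) :
  \prod_(i < m) (y + x * q ^+ i) =
  \sum_(k < m.+1) q ^+ 'C(k, 2) * qbinom m k * x ^+ k * y ^+ (m - k).
Proof.
elim: m x => [|m IHm] x; first by rewrite big_ord0 big_ord1 /= !mulr1.
rewrite big_ord_recl /=.
under eq_bigr => i _ do rewrite /bump /= add1n exprS mulrA.
rewrite IHm [RHS]big_ord_recl /= !mulr1 mul1r subn0.
have binS2 k : 'C(k.+1, 2) = ('C(k, 2) + k)%N by rewrite binS bin1.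
have -> : \sum_(k < m.+1) q ^+ 'C(lift ord0 k, 2) * qbinom m.+1 (lift ord0 k) *
      x ^+ lift ord0 k * y ^+ (m.+1 - lift ord0 k) =
    \sum_(k < m.+1) (x * (q ^+ 'C(k, 2) * qbinom m k * (x * q) ^+ k *
      y ^+ (m - k))) +
    \sum_(k < m.+1) (q ^+ ('C(k.+1, 2) + k.+1) * qbinom m k.+1 *
      x ^+ k.+1 * y ^+ (m - k)).
  rewrite -big_split; apply: eq_bigr => k _ /=.
  by rewrite /bump /= add1n subSS binS2 !exprD exprMn !exprS; ring.
rewrite mulrDl [X in _ = _ + X]addrC addrA -mulr_sumr; congr (_ + _).
rewrite big_ord_recl big_ord_recr /= qbinom0 !expr0 !mulr1 mul1r subn0.
rewrite (@qbinom_small m m.+1) // mulr0 !mul0r addr0 mulrDr -exprS; congr (_ + _).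
rewrite mulr_sumr; apply: eq_bigr => k _ /=.
rewrite /bump /= add1n (_ : (m - k)%N = (m - k.+1).+1); last first.
  by have := ltn_ord k; lia.
rewrite exprMn [y ^+ (m - k.+1).+1]exprS (exprD q _ k.+1).
by move: (q ^+ k.+1) => qk; ring.
Qed.

End QBinomial.

(** * The finite Jacobi triple product *)

Lemma sum_odd_square N : (\sum_(i < N) i.*2.+1 = N ^ 2)%N.
Proof. by elim: N => [|N IHN]; rewrite ?big_ord0 // big_ord_recr /= IHN; lia. Qed.

(* The q-binomial theorem at base [X^2] for [x = X] and [y = X^(2N)], divided by
   [X^(3N^2)]; this avoids the negative powers of the usual specialization. *)
Lemma finite_jacobi_triple_product (N : nat) :
  (\prod_(i < N) (1 + 'X^(i.*2.+1))) ^+ 2 =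
  \sum_(k < (N + N).+1)
    'X^(`|k%:Z - N%:Z| ^ 2) * qbinom 'X^2 (N + N) k :> {poly int}.
Proof.
have X_neq0 : 'X^(3 * N ^ 2) != 0 :> {poly int} by rewrite -size_poly_eq0 size_polyXn.
apply: (mulfI X_neq0).
(* The first [N] factors, in reverse order, give the odd product times [X^(N^2)]; the last [N] give
   it again times [X^(2N^2)]. *)
transitivity (\prod_(i < N + N) ('X^(N + N) + 'X * ('X^2) ^+ i) : {poly int}).
  rewrite big_split_ord /=.
  have -> : \prod_(i < N) ('X^(N + N) + 'X * ('X^2) ^+ i) =
            'X^(N ^ 2) * \prod_(i < N) (1 + 'X^(i.*2.+1)) :> {poly int}.
    rewrite -sum_odd_square -prodrXr [\prod_(i < N) (1 + _)](reindex_inj rev_ord_inj).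
    rewrite -big_split; apply: eq_bigr => i _ /=.
    rewrite mulrDr mulr1 -exprD -exprM -exprS addrC.
    by congr ('X^_ + 'X^_); have := ltn_ord i; lia.
  have -> : \prod_(i < N) ('X^(N + N) + 'X * ('X^2) ^+ (N + i)) =
            'X^((N + N) * N) * \prod_(i < N) (1 + 'X^(i.*2.+1)) :> {poly int}.
    rewrite exprM -[X in _ ^+ X * _]card_ord -prodr_const -big_split.
    apply: eq_bigr => i _ /=.
    rewrite mulrDr mulr1 -exprD -exprM -exprS.
    by congr ('X^_ + 'X^_); lia.
  rewrite mulrACA -exprD -expr2; congr ('X^_ * _); nia.
rewrite qbinomial_theorem mulr_sumr; apply: eq_bigr => k _.
rewrite -!exprM -mulrA -exprD mulrAC -exprD [RHS]mulrA -exprD.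
congr ('X^_ * _).
(* The exponents agree since [k^2 + 2N(2N - k) = 3N^2 + (k - N)^2]. *)
have C2 : ('C(k, 2) * 2 + k = k * k)%N.
  by elim: (k : nat) => // j IHj; rewrite binS bin1; lia.
rewrite addnA mulnC C2; have := ltn_ord k.
move: (nat_of_ord k) => {C2} j j_lt.
have [[e jE]|[e NE]] : (exists e, j = N + e)%N \/ (exists e, N = j + e)%N.
- by case: (leqP N j) => Nj; [left; exists (j - N)%N | right; exists (N - j)%N]; lia.
- rewrite jE (_ : `|_|%N = e); last by lia.
  by rewrite (_ : N + N - (N + e) = N - e)%N; nia.
- rewrite (_ : `|_|%N = e); last by lia.
  by rewrite NE (_ : j + e + (j + e) - j = j + e + e)%N; nia.
Qed.

(** * Generating functions of the two partition counts *)

Lemma qodd3_gf (n : nat) :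
  ((\prod_(i < n.+1 | odd i) (1 + 'X^i)) ^+ 3)`_n = (qodd3 n)%:R :> int.
Proof.
(* The value 0 at even parts kills every set containing one, so distributivity leaves one monomial
   per set of coloured odd parts. *)
pose F (x : 'I_n.+1 * 'I_3) : {poly int} := if odd x.1 then 'X^(x.1) else 0.
have -> : (\prod_(i < n.+1 | odd i) (1 + 'X^i)) ^+ 3 = \prod_x (F x + 1).
  rewrite -prodrXl big_mkcond -(pair_bigA _ (fun i c => F (i, c) + 1)) /=.
  apply: eq_bigr => i _; rewrite /F /= prodr_const card_ord.
  by case: ifP => _; rewrite ?add0r ?expr1n // addrC.
rewrite bigA_distr coef_sum /qodd3 cardsE -sum1_card natr_sum [RHS]big_mkcond.
apply: eq_bigr => A _ /=; rewrite unfold_in /= -big_mkcond /=.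
case: ifPn => [/andP[/forall_inP A_odd /eqP sumA]|].
  rewrite (eq_bigr (fun x : 'I_n.+1 * 'I_3 => 'X^(x.1))) => [|x /A_odd]; last by rewrite /F => ->.
  by rewrite prodrXr sumA coefXn eqxx.
rewrite negb_and negb_forall_in => A_bad.
have [/forall_inP A_odd|] := boolP [forall x in A, odd x.1].
  rewrite (eq_bigr (fun x : 'I_n.+1 * 'I_3 => 'X^(x.1))) => [|x /A_odd]; last by rewrite /F => ->.
  rewrite prodrXr coefXn eq_sym; case/orP: A_bad => [/exists_inP[x /A_odd->]//|].
  by move/negPf->.
rewrite negb_forall_in => /exists_inP[x xA /negPf x_even].
by rewrite (bigD1 x) //= /F x_even mul0r coef0.
Qed.

Lemma sumn_count (K : nat) (s : seq nat) : all (ltn^~ K) s ->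
  sumn s = (\sum_(i < K) i * count_mem (i : nat) s)%N.
Proof.
elim: s => [_|x s IHs /= /andP[x_lt /IHs ->]].
  by rewrite big1 // => i _; rewrite muln0.
under [RHS]eq_bigr => i _ do rewrite mulnDr.
rewrite big_split /=; congr (_ + _)%N.
rewrite (bigD1 (Ordinal x_lt)) //= eqxx muln1 big1 ?addn0 // => i.
by rewrite -val_eqE /= eq_sym => /negPf->; rewrite muln0.
Qed.

(* [r] is an allowed multiplicity of the part [i]; the part 0 is forbidden. *)
Definition pod_mult (i r : nat) : bool :=
  if i == 0%N then r == 0%N else odd i ==> (r <= 1)%N.

Lemma pod_multP (s : seq nat) :
  reflect (forall i, pod_mult i (count_mem i s))
          (all (ltn 0) s && odd_parts_distinct s).
Proof.
have cnt_odd i : count_mem i [seq i <- s | odd i] = (odd i * count_mem i s)%N.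
  rewrite count_filter; case: (boolP (odd i)) => i_odd.
    rewrite mul1n; apply: eq_count => x /=.
    by case: eqP => // ->; rewrite i_odd.
  rewrite mul0n (eq_count (a2 := pred0)) ?count_pred0 // => x /=.
  by case: eqP => // ->; rewrite (negPf i_odd).
apply: (iffP andP) => [[s_gt0 s_uniq] i|s_mult].
  rewrite /pod_mult; case: eqP => [->|_].
    by rewrite -leqn0 leqNgt -has_count; apply/hasPn => x /(allP s_gt0); case: x.
  apply/implyP => i_odd; have := count_uniq_mem i s_uniq.
  by rewrite cnt_odd i_odd mul1n => ->; case: (_ \in _).
split.
  apply/allP => -[|//] s0; have := s_mult 0%N.
  by rewrite /pod_mult eqxx => /eqP/count_memPn; rewrite s0.
apply: count_mem_uniq => i; rewrite -has_pred1 has_count cnt_odd.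
have := s_mult i; rewrite /pod_mult.
by case: (odd i) (i =P 0%N) => [] [->|_] //=; lia.
Qed.

Lemma count_memP (s t : seq nat) :
  sorted geq s -> sorted geq t -> (forall i, count_mem i s = count_mem i t) ->
  s = t.
Proof.
move=> s_sorted t_sorted st; apply: (sorted_eq _ _ s_sorted t_sorted).
- by move=> y x z /=; lia.
- by move=> x y /=; lia.
- by rewrite /perm_eq; apply/allP => x _ /=; rewrite st.
Qed.

(** Expanding the product chooses a multiplicity for each part; [mult] matches partitions with these
    choices. A single truncation at [n] serves every [m <= n], as the sum over [j] requires. *)
Lemma pod_gf (n m : nat) : (m <= n)%N ->
  (\prod_(i < n.+1) \sum_(r < n.+1 | pod_mult i r) 'X^(i * r))`_m =
  (pod_nat m)%:R :> int.
Proof.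
move=> m_le; rewrite bigA_distr_big_dep coef_sum.
under eq_bigr => f _ do rewrite prodrXr coefXn.
rewrite -natr_sum; congr (_%:R); rewrite /pod_nat.
set B := [set b | _]%SET.
pose mult (b : {bseq m of 'I_m.+1}) : {ffun 'I_n.+1 -> 'I_n.+1} :=
  [ffun i : 'I_n.+1 => inord (count_mem (i : nat) (parts b))].
have partsP b : b \in B -> [/\ sorted geq (parts b), sumn (parts b) = m &
    forall i, pod_mult i (count_mem i (parts b))].
  rewrite inE => /andP[/and3P[b_sorted b_gt0 /eqP b_sum] b_odd]; split=> //.
  by apply/pod_multP; rewrite b_gt0.
have size_parts (b : {bseq m of 'I_m.+1}) : (size (parts b) <= m)%N.
  by rewrite size_map; apply: size_bseq.
have parts_lt (b : {bseq m of 'I_m.+1}) : all (ltn^~ n.+1) (parts b).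
  by apply/allP => _ /mapP[i _ ->]; have := ltn_ord i; rewrite /=; lia.
(* A multiplicity is at most the number of parts, hence at most [n], so [inord] never takes its
   default value. *)
have multE b (i : 'I_n.+1) : mult b i = count_mem (i : nat) (parts b) :> nat.
  rewrite ffunE inordK // ltnS (leq_trans (count_size _ _)) //.
  exact: leq_trans (size_parts b) m_le.
have mult_inj : {in B &, injective mult}.
  move=> b c /partsP[b_sorted _ _] /partsP[c_sorted _ _] bc.
  apply/val_inj/(inj_map val_inj)/count_memP => // i.
  have [i_lt|i_ge] := ltnP i n.+1.
    by rewrite -[i]/(nat_of_ord (Ordinal i_lt)) -!multE bc.
  have cnt0 (d : {bseq m of 'I_m.+1}) : count_mem i (parts d) = 0%N.
    by apply/count_memPn/negP => /(allP (parts_lt d)) /=; lia.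
  by rewrite !cnt0.
rewrite -(card_in_imset mult_inj) -sum1_card [in LHS]big_mkcond [RHS]big_mkcond.
apply: eq_bigr => f _ /=.
case: (boolP (f \in mult @: B)) => [/imsetP[b /partsP[b_sorted b_sum b_mult] ->]|].
  rewrite ifT; last by apply/familyP => i; rewrite unfold_in multE.
  under eq_bigr => i _ do rewrite multE.
  by rewrite -sumn_count // b_sum eqxx.
case: familyP => // f_mult; apply: contraNeq; rewrite eqb0 negbK => /eqP f_sum.
(* Surjectivity of [mult]: an admissible [f] of weight [m] is realized by repeating each [i] exactly
   [f i] times and sorting. *)
pose t := flatten [seq nseq (f i) (nat_of_ord i) | i <- enum 'I_n.+1].
pose s := sort geq t.
have s_cnt (j : 'I_n.+1) : count_mem (j : nat) s = f j.
  rewrite /s (permP (permEl (perm_sort _ _))) count_flatten sumnE !big_map -enumT big_enum /=.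
  rewrite (bigD1 j) //= count_nseq /= eqxx mul1n big1 ?addn0 // => i.
  by rewrite -val_eqE count_nseq /= => /negPf->.
have s_lt : all (ltn^~ n.+1) s.
  rewrite all_sort; apply/allP => x /flatten_mapP[i _]; rewrite mem_nseq.
  by case/andP=> _ /eqP->; apply: ltn_ord.
have s_part : is_partition m s && odd_parts_distinct s.
  have s_sorted : sorted geq s by apply: sort_sorted => x y /=; lia.
  have s_sum : sumn s = m.
    rewrite (sumn_count s_lt) f_sum; apply: eq_bigr => i _.
    by rewrite s_cnt.
  rewrite /is_partition s_sorted s_sum eqxx andbT; apply/pod_multP => i.
  have [i_lt|i_ge] := ltnP i n.+1.
    by rewrite (s_cnt (Ordinal i_lt)); apply: (f_mult (Ordinal i_lt)).
  rewrite (count_memPn _); first by rewrite /pod_mult eqxx implybT; case: i i_ge.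
  by apply/negP => /(allP s_lt) /=; lia.
have [b [bs _]] := partition_parts (andP s_part).1.
apply/imsetP; exists b; first by rewrite inE bs.
by apply/ffunP => i; apply: val_inj; rewrite /= multE bs s_cnt.
Qed.

(** * Odd and even parts, and the limit of the triple product modulo [X^(n+1)] *)

Lemma prod_odd (V : comNzRingType) (F : nat -> V) N :
  \prod_(i < N) F i.*2.+1 = \prod_(i < N.*2.+1 | odd i) F i.
Proof.
rewrite [RHS]big_mkcond; elim: N => [|N IHN].
  by rewrite big_ord0 big_ord1.
by rewrite doubleS [LHS]big_ord_recr 2![in RHS]big_ord_recr /= -IHN odd_double mulr1.
Qed.

Lemma prod_even (V : comNzRingType) (F : nat -> V) N :
  \prod_(i < N) F i.+1.*2 =
  \prod_(i < N.*2.+1 | ~~ odd i && (0 < i)%N) F i.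
Proof.
rewrite [RHS]big_mkcond; elim: N => [|N IHN].
  by rewrite big_ord0 big_ord1.
by rewrite doubleS [LHS]big_ord_recr 2![in RHS]big_ord_recr /= -IHN !odd_double /= mulr1.
Qed.

Definition odd_gf n : {poly int} := \prod_(i < n.+1 | odd i) (1 + 'X^i).

(** A polynomial stand-in for [prod_k 1 / (1 - X^(2k))], exact up to degree [n]. *)
Definition even_gf n : {poly int} :=
  \prod_(i < n.+1 | ~~ odd i && (0 < i)%N) \sum_(r < n.+1) 'X^(i * r).

Lemma pod_gf_odd_even (n m : nat) : (m <= n)%N ->
  (odd_gf n * even_gf n)`_m = (pod_nat m)%:R.
Proof.
move=> m_le; rewrite -(pod_gf m_le); congr ((polyseq _)`_m).
rewrite [RHS](bigID (fun i : 'I_n.+1 => odd i)) /=; congr (_ * _).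
  apply: eq_bigr => i i_odd.
  (* An odd [i <= n] forces [n >= 1], so the multiplicity 1 is in range. *)
  have n_gt0 : (1 < n.+1)%N by have := ltn_ord i; case: (nat_of_ord i) i_odd; lia.
  rewrite (bigD1 ord0) /=; last by rewrite /pod_mult i_odd; case: ifP.
  rewrite (bigD1 (Ordinal n_gt0)) /=; last first.
    by rewrite /pod_mult i_odd; case: eqP i_odd => // ->.
  rewrite muln0 muln1 big1 ?addr0 // => r.
  rewrite /pod_mult i_odd -!val_eqE /=; case: (nat_of_ord i) i_odd => //= j _.
  by case: (nat_of_ord r) => [|[|]].
rewrite /even_gf big_mkcondr; apply: eq_bigr => i i_even; rewrite /pod_mult.
case: posnP => [->|i_gt0]; last first.
  by apply: eq_bigl => r; rewrite (negPf i_even).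
by rewrite (big_pred1 ord0) ?mul0n.
Qed.

Lemma odd_gf_upto n N : (n <= N.*2)%N ->
  eq_upto n (\prod_(i < N) (1 + 'X^(i.*2.+1))) (odd_gf n).
Proof.
move=> n_le; rewrite (prod_odd (fun i => 1 + 'X^i : {poly int})).
apply: (@eq_upto_prod_tail _ _ _ odd (fun i => 1 + 'X^i)) => // i.
exact: eq_upto_1DXn.
Qed.

(** Each truncated geometric series times [1 - X^i] telescopes to [1 - X^(i(n+1))], and the factors
    of [qfact] of degree above [n] are congruent to 1. *)
Lemma even_gf_qfact n M : (n <= M)%N -> eq_upto n (even_gf n * qfact 'X^2 M) 1.
Proof.
move=> n_le; pose D : {poly int} :=
  \prod_(i < n.+1 | ~~ odd i && (0 < i)%N) (1 - 'X^i).
have qfactD : eq_upto n (qfact 'X^2 M) D.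
  have -> : qfact 'X^2 M = \prod_(i < M) (1 - 'X^(i.+1.*2)) :> {poly int}.
    by apply: eq_bigr => i _; rewrite -exprM mul2n.
  rewrite (prod_even (fun i => 1 - 'X^i : {poly int})).
  apply: (@eq_upto_prod_tail _ _ _ (fun i => ~~ odd i && (0 < i)%N)
    (fun i => 1 - 'X^i)); last by lia.
  exact: eq_upto_1BXn.
apply: (eq_upto_trans (eq_uptoM (eq_upto_refl _) qfactD)).
rewrite /even_gf /D -big_split; apply: eq_upto_prod1 => i /andP[_ i_gt0] /=.
have -> : (\sum_(r < n.+1) 'X^(i * r)) * (1 - 'X^i) = 1 - 'X^(i * n.+1) :> {poly int}.
  rewrite exprM -[RHS]opprB subrX1 -mulNr opprB mulrC; congr (_ * _).
  by apply: eq_bigr => r _; rewrite exprM.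
by apply: eq_upto_1BXn; nia.
Qed.

(** Inverses replace division: [B] is congruent to [B] times two copies of 1, which [qbinomM_qfact]
    turns into [E * (E * qfact 'X^2 (a + b))], congruent to [E]. *)
Lemma qbinom_upto n a b : (n <= a)%N -> (n <= b)%N ->
  eq_upto n (qbinom 'X^2 (a + b) a) (even_gf n).
Proof.
move=> n_le_a n_le_b; set E := even_gf n; set B := qbinom _ _ _.
have Ea : eq_upto n (E * qfact 'X^2 a) 1 by apply: even_gf_qfact.
have Eb : eq_upto n (E * qfact 'X^2 b) 1 by apply: even_gf_qfact.
apply: (@eq_upto_trans _ _ (B * (E * qfact 'X^2 a) * (E * qfact 'X^2 b))).
  rewrite -[X in eq_upto _ X]mulr1 -[X in eq_upto _ (X * _)]mulr1; apply/eq_upto_sym/eq_uptoM => //.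
  by apply: eq_uptoM.
have -> : B * (E * qfact 'X^2 a) * (E * qfact 'X^2 b) =
          E * (E * qfact 'X^2 (a + b)).
  by rewrite -qbinomM_qfact -/B; ring.
rewrite -[X in eq_upto _ _ X]mulr1; apply: eq_uptoM => //.
by apply: even_gf_qfact; lia.
Qed.

Lemma theta_upto n :
  eq_upto n (odd_gf n ^+ 2)
    (even_gf n * \sum_(k < (n.*2 + n.*2).+1) 'X^(`|k%:Z - (n.*2)%:Z| ^ 2)).
Proof.
apply: (@eq_upto_trans _ _ ((\prod_(i < n.*2) (1 + 'X^(i.*2.+1))) ^+ 2)).
  by apply/eq_upto_sym; rewrite !expr2; apply: eq_uptoM; apply: odd_gf_upto; lia.
rewrite finite_jacobi_triple_product mulr_sumr; apply: eq_upto_sum => k _.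
rewrite mulrC; have := ltn_ord k; move: (nat_of_ord k) => {}k k_lt.
(* With [N = 2n], far terms have a square above [n] and vanish; near ones have both [k] and [2N - k]
   at least [n]. *)
have [far|near] := ltnP n (`|k%:Z - (n.*2)%:Z|)%N.
  have X0 : eq_upto n ('X^(`|k%:Z - (n.*2)%:Z| ^ 2)) (0 : {poly int}).
    by apply: eq_uptoXn0; nia.
  apply: (eq_upto_trans (eq_uptoM (eq_upto_refl _) X0)).
  by rewrite mulr0 -(mulr0 (even_gf n)); apply/eq_uptoM/eq_upto_sym.
apply: eq_uptoM => //.
rewrite (_ : (n.*2 + n.*2 = k + (n.*2 + n.*2 - k))%N); last by lia.
by apply: qbinom_upto; lia.
Qed.

Theorem theorem4p16 (n : nat) :
  qodd3 n = \big[addn/0%N]_(j \in [set: int]) pod (n%:Z - j ^+ 2).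
Proof.
(* The window from [-2n] to [2n], indexed as in [theta_upto]; outside it [n - j^2] is negative. *)
pose r := [seq k%:Z - (n.*2)%:Z | k <- iota 0 (n.*2 + n.*2).+1].
have r_uniq : uniq r.
  by rewrite map_inj_uniq ?iota_uniq // => k l /addIr[].
rewrite (@fsbigE _ _ _ _ _ r) //; last first.
  move=> j _ /mapP j_out; case E: (n%:Z - j ^+ 2) => [m|//].
  case: j_out; exists `|(j + (n.*2)%:Z)%R|%N; last by move: E; rewrite expr2; nia.
  by rewrite mem_iota; move: E; rewrite expr2; nia.
under eq_bigl => j do rewrite in_setT.
rewrite big_map -{1}[(n.*2 + n.*2).+1]subn0 -/(index_iota _ _) big_mkord.
apply/eqP; rewrite -(eqr_nat int) natr_sum -qodd3_gf -/(odd_gf n) exprS.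
(* Two colours become theta times [even_gf n]; the third joins [even_gf n] to form the [pod]
   series. *)
rewrite (eq_uptoM (eq_upto_refl _) (@theta_upto n)) // mulrA mulr_sumr coef_sum.
apply/eqP/eq_bigr => k _; rewrite coefMXn.
case: ltnP => [lt_n|n_ge].
  by case E: (n%:Z - _) => [m|//]; move: E; rewrite expr2; nia.
rewrite pod_gf_odd_even ?leq_subr //.
rewrite (_ : n%:Z - _ = (n - `|k%:Z - (n.*2)%:Z| ^ 2)%N%:Z) //.
by rewrite expr2; nia.
Qed.
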